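(* Let $G$ be a simply connected Lie group with Lie algebra $\mathfrak{g}$, let $k^+$ be a left invariant flat pseudo-Riemannian metric on $G$, and let $\nabla$ be its Levi-Civita connection. Let $\nabla^H$ be the left invariant Hess connection and $J$ the left invariant complex structure induced by $j$ on the Lie group $T^\ast G$, as described in the context. Then $\nabla^H J=0$.
   Context: For $x\in\mathfrak{g}$ let $x^+$ be the associated left invariant vector field, put $L_x(y)=x\cdot y:=(\nabla_{x^+}y^+)(e)$, let $L^\ast_x(\alpha)=-\alpha\circ L_x$ be the dual representation of $\mathfrak{g}$ on $\mathfrak{g}^\ast$, let $F:G\to\mathrm{GL}(\mathfrak{g}^\ast)$ be the Lie group homomorphism with differential $L^\ast$, and let $k=k^+_e$. The cotangent bundle $T^\ast G\approx G\times\mathfrak{g}^\ast$ is a Lie group with product $(g,\alpha)\cdot(g',\beta)=(gg',F(g)(\beta)+\alpha)$; its Lie algebra is $\mathfrak{g}\oplus\mathfrak{g}^\ast$ with bracket $[x+\alpha,y+\beta]_\ast=[x,y]+L^\ast_x(\beta)-L^\ast_y(\alpha)$. The Hess connection $\nabla^H$ is the left invariant connection on $T^\ast G$ given by $\nabla^H_{(x+\alpha)^+}(y+\beta)^+=(x\cdot y+L_x^\ast(\beta))^+$ for $x,y\in\mathfrak{g}$, $\alpha,\beta\in\mathfrak{g}^\ast$. $j$ is the linear complex structure on $\mathfrak{g}\oplus\mathfrak{g}^\ast$ given by $j(x+\alpha)=z_\alpha-k^\flat(x)$, where $k^\flat:\mathfrak{g}\to\mathfrak{g}^\ast$, $k^\flat(x)=k(x,\cdot)$,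 and $z_\alpha\in\mathfrak{g}$ is the unique element with $k^\flat(z_\alpha)=\alpha$. $J$ is the left invariant extension of $j$ to $T^\ast G$. *)

(* Defs.v *)
From HB Require Import structures.
From mathcomp Require Import all_boot all_order all_algebra.
From mathcomp Require Import boolp classical_sets functions set_interval reals.
From mathcomp Require Import topology normedtype derive.

Set Implicit Arguments.
Unset Strict Implicit.
Unset Printing Implicit Defensive.

Import Order.TTheory GRing.Theory Num.Theory.
Import numFieldNormedType.Exports.

Local Open Scope classical_set_scope.
Local Open Scope ring_scope.

(* [smooth_on] is only meant for open [U] and finite-dimensional [V]: there,
   "the directional derivatives of f are C^k" amounts to "Df is C^k". *)
Section SmoothOn.
Variables (R : realType) (V W : normedModType R).

Fixpoint Ck (k : nat) (U : set V) (f : V -> W) : Prop :=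
  match k with
  | 0%N => forall x, U x -> {for x, continuous f}
  | k'.+1 => (forall x, U x -> differentiable f x) /\
             (forall v : V, Ck k' U (fun x => 'd f x v))
  end.

Definition smooth_on (U : set V) (f : V -> W) : Prop := forall k, Ck k U f.

End SmoothOn.

(* Manifolds are presented by an atlas with one chart [chart p] around each
   point p (with domain [chart_dom p]); every manifold has such an atlas.  The
   tangent space at p is the model space V, a tangent vector being given by its
   coordinates in the chart [chart p]. *)
Record chartedSpace (R : realType) (V : normedModType R) := ChartedSpace {
  pt :> topologicalType;
  chart_dom : pt -> set pt;
  chart : pt -> pt -> V;
  chart_inv : pt -> V -> pt }.

Definition vec_charted (R : realType) (V : normedModType R) : chartedSpace V :=
  @ChartedSpace R V V (fun _ => setT) (fun _ v => v) (fun _ v => v).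

Definition prod_charted (R : realType) (V W : normedModType R)
    (M : chartedSpace V) (N : chartedSpace W) : chartedSpace (V * W)%type :=
  @ChartedSpace R (V * W)%type (M * N)%type
    (fun p => chart_dom p.1 `*` chart_dom p.2)
    (fun p q => (chart p.1 q.1, chart p.2 q.2))
    (fun p v => (chart_inv p.1 v.1, chart_inv p.2 v.2)).

Definition chart_img (R : realType) (V : normedModType R) (M : chartedSpace V)
  (p : M) : set V := chart p @` chart_dom p.

Record smooth_manifold (R : realType) (V : normedModType R)
    (M : chartedSpace V) : Prop := SmoothManifold {
  sm_hausdorff : hausdorff_space M;
  sm_countable : @second_countable M;
  sm_mem : forall p : M, chart_dom p p;
  sm_open : forall p : M, open (chart_dom p);
  sm_open_img : forall p : M, open (chart_img p);
  sm_cancel : forall p q : M, chart_dom p q -> chart_inv p (chart p q) = q;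
  sm_continuous : forall p : M, {within chart_dom p, continuous (chart p)};
  sm_continuous_inv : forall p : M,
    {within chart_img p, continuous (chart_inv p)};
  sm_transition : forall p q : M,
    smooth_on (chart p @` (chart_dom p `&` chart_dom q))
      (fun x => chart q (chart_inv p x)) }.

Section SmoothMaps.
Variables (R : realType) (V W : normedModType R).
Variables (M : chartedSpace V) (N : chartedSpace W).

Definition smooth_map (f : M -> N) : Prop :=
  continuous f /\
  forall (p : M) (q : N),
    smooth_on (chart p @` (chart_dom p `&` f @^-1` chart_dom q))
      (fun x => chart q (f (chart_inv p x))).

(* The differential T_p M -> T_(f p) N. *)
Definition tangent_map (f : M -> N) (p : M) : V -> W :=
  'd (fun x => chart (f p) (f (chart_inv p x))) (chart p p).

End SmoothMaps.
Arguments smooth_map {R V W} M N f.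
Arguments tangent_map {R V W} M N f p.

Section TensorFields.
Variables (R : realType) (V : normedModType R) (M : chartedSpace V).

(* The components of the vector field X in the chart [chart q]. *)
Definition field_rep (q : M) (X : M -> V) : V -> V :=
  fun x => let p := chart_inv q x in
    tangent_map M (vec_charted V) (chart q) p (X p).

Definition smooth_field (X : M -> V) : Prop :=
  forall q : M, smooth_on (chart_img q) (field_rep q X).

Definition smooth_fun (f : M -> R^o) : Prop := smooth_map M (vec_charted R^o) f.

Definition field_app (X : M -> V) (f : M -> R^o) : M -> R^o :=
  fun p => tangent_map M (vec_charted R^o) f p (X p).

Definition lie_bracket (X Y : M -> V) : M -> V :=
  fun p => 'd (field_rep p Y) (chart p p) (X p)
         - 'd (field_rep p X) (chart p p) (Y p).

(* Connections act on smooth vector fields; their values on non-smooth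
   functions M -> V are irrelevant. *)
Record is_connection (D : (M -> V) -> (M -> V) -> (M -> V)) : Prop :=
  IsConnection {
  conn_smooth : forall X Y,
    smooth_field X -> smooth_field Y -> smooth_field (D X Y);
  conn_addl : forall X X' Y,
    smooth_field X -> smooth_field X' -> smooth_field Y ->
    forall p, D (fun q => X q + X' q) Y p = D X Y p + D X' Y p;
  conn_scalel : forall f X Y,
    smooth_fun f -> smooth_field X -> smooth_field Y ->
    forall p, D (fun q => f q *: X q) Y p = f p *: D X Y p;
  conn_addr : forall X Y Y',
    smooth_field X -> smooth_field Y -> smooth_field Y' ->
    forall p, D X (fun q => Y q + Y' q) p = D X Y p + D X Y' p;
  conn_leibniz : forall f X Y,
    smooth_fun f -> smooth_field X -> smooth_field Y ->
    forall p, D X (fun q => f q *: Y q) p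
              = field_app X f p *: Y p + f p *: D X Y p }.

Record is_pseudo_riemannian (h : M -> V -> V -> R^o) : Prop :=
  IsPseudoRiemannian {
  pr_linear : forall p (a : R) u v w, h p (a *: u + v) w = a * h p u w + h p v w;
  pr_sym : forall p u v, h p u v = h p v u;
  pr_nondegenerate : forall p u, (forall v, h p u v = 0) -> u = 0;
  pr_smooth : forall (q : M) (u v : V), smooth_on (chart_img q)
    (fun x => let d := tangent_map (vec_charted V) M (chart_inv q) x in
              h (chart_inv q x) (d u) (d v)) }.

Record is_levi_civita (h : M -> V -> V -> R^o)
    (D : (M -> V) -> (M -> V) -> (M -> V)) : Prop := IsLeviCivita {
  lc_connection : is_connection D;
  lc_torsion_free : forall X Y, smooth_field X -> smooth_field Y ->
    forall p, D X Y p - D Y X p = lie_bracket X Y p;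
  lc_metric : forall X Y Z,
    smooth_field X -> smooth_field Y -> smooth_field Z ->
    forall p, field_app X (fun q => h q (Y q) (Z q)) p
              = h p (D X Y p) (Z p) + h p (Y p) (D X Z p) }.

Definition curvature (D : (M -> V) -> (M -> V) -> (M -> V)) (X Y Z : M -> V) :
    M -> V :=
  fun p => D X (D Y Z) p - D Y (D X Z) p - D (lie_bracket X Y) Z p.

Definition flat (D : (M -> V) -> (M -> V) -> (M -> V)) : Prop :=
  forall X Y Z, smooth_field X -> smooth_field Y -> smooth_field Z ->
  forall p, curvature D X Y Z p = 0.

(* (D_X J) Y for a field of endomorphisms J. *)
Definition cov_deriv_endo (D : (M -> V) -> (M -> V) -> (M -> V))
    (J : M -> V -> V) (X Y : M -> V) : M -> V :=
  fun p => D X (fun q => J q (Y q)) p - J p (D X Y p).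

Definition parallel_endo (D : (M -> V) -> (M -> V) -> (M -> V))
    (J : M -> V -> V) : Prop :=
  forall X Y, smooth_field X -> smooth_field Y ->
  forall p, cov_deriv_endo D J X Y p = 0.

End TensorFields.

Record lieData (R : realType) (V : normedModType R) := LieData {
  lie_charted :> chartedSpace V;
  lie_mul : lie_charted -> lie_charted -> lie_charted;
  lie_one : lie_charted;
  lie_inv : lie_charted -> lie_charted }.

Arguments lie_one {R V} l.

Record is_lie_group (R : realType) (V : normedModType R) (G : lieData V) :
    Prop := IsLieGroup {
  lg_manifold : smooth_manifold G;
  lg_assoc : associative (@lie_mul R V G);
  lg_one_mul : left_id (lie_one G) (@lie_mul R V G);
  lg_inv_mul : left_inverse (lie_one G) (@lie_inv R V G) (@lie_mul R V G);
  lg_smooth_mul : smooth_map (prod_charted G G) G (fun p => lie_mul p.1 p.2);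
  lg_smooth_inv : smooth_map G G (@lie_inv R V G) }.

Definition simply_connected (R : realType) (T : topologicalType) : Prop :=
  (forall x y : T, exists c : R -> T,
     [/\ {within `[0, 1], continuous c}, c 0 = x & c 1 = y]) /\
  (forall c : R -> T, {within `[0, 1], continuous c} -> c 0 = c 1 ->
   exists H : R * R -> T,
     [/\ {within `[0, 1] `*` `[0, 1], continuous H},
         forall t, t \in `[0, 1] -> H (t, 0) = c t,
         forall t, t \in `[0, 1] -> H (t, 1) = c 0 &
         forall s, s \in `[0, 1] -> H (0, s) = c 0 /\ H (1, s) = c 0]).

Section LeftInvariance.
Variables (R : realType) (V : normedModType R) (G : lieData V).

(* The Lie algebra is the tangent space V at the neutral element; [left_field x]
   is the left invariant vector field x^+. *)
Definition left_field (x : V) : G -> V :=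
  fun g => tangent_map G G (lie_mul g) (lie_one G) x.

(* At g : dL_g o j o dL_(g^-1). *)
Definition left_endo (j : V -> V) : G -> V -> V :=
  fun g v => tangent_map G G (lie_mul g) (lie_one G)
               (j (tangent_map G G (lie_mul (lie_inv g)) g v)).

Definition left_invariant_metric (h : G -> V -> V -> R^o) : Prop :=
  forall (g p : G) (u v : V),
    h (lie_mul g p) (tangent_map G G (lie_mul g) p u)
                    (tangent_map G G (lie_mul g) p v) = h p u v.

(* x . y *)
Definition lsa (D : (G -> V) -> (G -> V) -> (G -> V)) (x y : V) : V :=
  D (left_field x) (left_field y) (lie_one G).

End LeftInvariance.
Arguments left_field {R V} G x _.
Arguments left_endo {R V} G j _ _.

(* Elements of the Lie algebra are row vectors and linear forms on it are column
   vectors a, evaluated at x by the product x *m a; thus GL(g^* ) consists of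
   the invertible matrices acting on the left of columns. *)
Section Cotangent.
Variables (R : realType) (n : nat).

Definition ev (a : 'cV[R]_n) (x : 'rV[R]_n) : R := (x *m a) 0 0.

Definition covec (f : 'rV[R]_n -> R) : 'cV[R]_n := \col_i f (delta_mx 0 i).

Definition dual_rep (L : 'rV[R]_n -> 'rV[R]_n -> 'rV[R]_n) (x : 'rV[R]_n)
  (a : 'cV[R]_n) : 'cV[R]_n := covec (fun y => - ev a (L x y)).

Definition flat_map (k : 'rV[R]_n -> 'rV[R]_n -> R) (x : 'rV[R]_n) :
  'cV[R]_n := covec (k x).

Definition sharp_map (k : 'rV[R]_n -> 'rV[R]_n -> R) (a : 'cV[R]_n) :
  'rV[R]_n := get [set z | flat_map k z = a].

Definition jmap (k : 'rV[R]_n -> 'rV[R]_n -> R)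
    (u : 'rV[R]_n * 'cV[R]_n) : 'rV[R]_n * 'cV[R]_n :=
  (sharp_map k u.2, - flat_map k u.1).

Variable G : lieData 'rV[R]_n.

Record is_GL_dual_hom (F : G -> 'M[R]_n) : Prop := IsGLDualHom {
  gl_smooth : smooth_map G (vec_charted 'M[R]_n) F;
  gl_unit : forall g, F g \in unitmx;
  gl_mul : forall g h, F (lie_mul g h) = F g *m F h }.

Definition has_differential (F : G -> 'M[R]_n)
    (rho : 'rV[R]_n -> 'cV[R]_n -> 'cV[R]_n) : Prop :=
  forall x a,
    tangent_map G (vec_charted 'M[R]_n) F (lie_one G) x *m a = rho x a.

(* T^*G, trivialized as G * g^*. *)
Definition cotangent (F : G -> 'M[R]_n) :
    lieData ('rV[R]_n * 'cV[R]_n)%type :=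
  @LieData R ('rV[R]_n * 'cV[R]_n)%type
    (prod_charted G (vec_charted 'cV[R]_n))
    (fun p q => (lie_mul p.1 q.1, F p.1 *m q.2 + p.2))
    (lie_one G, 0)
    (fun p => (lie_inv p.1, - (F (lie_inv p.1) *m p.2))).

Definition is_hess (F : G -> 'M[R]_n)
    (L : 'rV[R]_n -> 'rV[R]_n -> 'rV[R]_n)
    (DH : (cotangent F -> 'rV[R]_n * 'cV[R]_n) ->
          (cotangent F -> 'rV[R]_n * 'cV[R]_n) ->
          (cotangent F -> 'rV[R]_n * 'cV[R]_n)) : Prop :=
  is_connection DH /\
  forall (x y : 'rV[R]_n) (a b : 'cV[R]_n) (p : cotangent F),
    DH (left_field (cotangent F) (x, a)) (left_field (cotangent F) (y, b)) p
    = left_field (cotangent F) (L x y, dual_rep L x b) p.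

End Cotangent.

(* Main.v *)
Require Import Defs.
From HB Require Import structures.
From mathcomp Require Import all_boot all_order all_algebra.
From mathcomp Require Import boolp classical_sets functions set_interval reals.
From mathcomp Require Import topology normedtype derive.
From mathcomp Require Import landau interval_inference.

(** Both nabla^H and J are left invariant, so the claim reduces to an identity
    in the Lie algebra.

    Algebra. With L_x y = x . y and k = kp e, left invariance of kp makes
    kp (y^+, z^+) a constant function, and metric compatibility of nabla at the
    neutral element says that L_x is skew for k ([lsa_skew]).  Equivalently,
    the musical isomorphism k^flat intertwines L_x with the dual representation
    L^*_x ([dual_rep_flat_map]).  Hence B_x (y + b) = L_x y + L^*_x b, which
    gives the Hess connection on left invariant fields, commutes with j, which
    exchanges g and g^* by means of k^flat ([jmap_hess]).

    Analysis. Let (b_i) be a basis of the Lie algebra.  Any smooth field Y is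
    Y = sum_i f_i b_i^+, where f_i is the i-th coordinate of the Maurer-Cartan
    form p |-> (dL_(p^-1)) (Y p); the f_i are smooth because (p, q) |-> p^-1 q
    is ([smooth_maurer_cartan]).  Since J is pointwise linear and maps b_i^+ to
    (j b_i)^+, the Leibniz rule gives
      D_X (J Y) = sum_i (X f_i) (j b_i)^+ + f_i D_X (j b_i)^+,
      J (D_X Y) = sum_i (X f_i) (j b_i)^+ + f_i J (D_X b_i^+),
    and after expanding X in the same frame the two agree by B_x j = j B_x
    ([parallel_left_endo]).

    The general statement is applied to T^*G, whose charts, group laws and
    smoothness of operations come from those of G and from the representation F
    ([smooth_group_cotangent]).  Everything rests on a calculus of C^k maps
    between open subsets of finite-dimensional spaces, in which the composition
    law [Ck_comp] carries the weight. *)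

Set Implicit Arguments.
Unset Strict Implicit.
Unset Printing Implicit Defensive.

Import Order.TTheory GRing.Theory Num.Theory.
Import numFieldNormedType.Exports.

Local Open Scope classical_set_scope.
Local Open Scope ring_scope.

(** * Calculus of C^k maps *)

Section DiffLemmas.
Variable R : realType.

(** 'd is defined by choosing a linear map, so equality of germs transfers it only
    through the uniqueness of the differential. *)
Lemma near_eq_diff (V W : normedModType R) (f g : V -> W) (x : V) :
  (\forall y \near x, f y = g y) -> differentiable f x ->
  differentiable g x /\ 'd g x = 'd f x :> (V -> W).
Proof.
move=> fg df.
have gl : g \o shift x = cst (g x) + 'd f x +o_ (0 : V) id.
  apply/eqaddoP => _/posnumP[e].
  have /diff_locally/eqaddoP/(_ _ [gt0 of e%:num]) := df.
  have fg0 : \forall y \near (0 : V), f (y + x) = g (y + x).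
    by move: fg; rewrite (near_shift 0 x) /= subr0.
  rewrite !near_simpl; apply: filter_app; near=> y => /=.
  rewrite !fctE /= (nbhs_singleton fg).
  by have -> : f (y + x) = g (y + x) by near: y.
have E := @diff_unique R V W g _ x (diff_continuous df) gl.
split=> //; apply/diff_locallyP; rewrite E; split=> //.
exact: diff_continuous.
Unshelve. all: by end_near. Qed.

Lemma diff_pair_cst (V Z W : normedModType R) (m : V * Z -> W) y (z x : Z) :
  differentiable m (y, z) ->
  'd (fun t => m (y, t)) z x = 'd m (y, z) (0, x).
Proof.
move=> dm.
have dp : differentiable (fun t : Z => (y, t)) z by exact: differentiable_pair.
rewrite (@diff_comp _ _ _ _ (fun t : Z => (y, t)) m z dp dm) /=.
rewrite diff_pair// (_ : (fun=> y) = cst y)// diff_cst.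
by rewrite (_ : (fun t : Z => t) = id)// (@diff_val _ _ _ _ _ _ id).
Qed.

End DiffLemmas.

Section CkCalculus.
Variable R : realType.
Implicit Types V W Z X : normedModType R.

Lemma CkS V W k (U : set V) (f : V -> W) : Ck k.+1 U f -> Ck k U f.
Proof.
elim: k f => [|k IH] f [df Df]; last by split=> // v; exact/IH/Df.
by move=> x Ux; exact/differentiable_continuous/df.
Qed.

Lemma Ck_continuous V W k (U : set V) (f : V -> W) :
  Ck k U f -> forall x, U x -> {for x, continuous f}.
Proof. by elim: k => [|k IH] // /CkS /IH. Qed.

(** [Ck k U f] is a conjunction over the points of U, so any set around each point
    will do here, open or not. *)
Lemma Ck_local V W k (U : set V) (f : V -> W) :
  (forall x, U x -> exists A, A x /\ Ck k A f) -> Ck k U f.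
Proof.
elim: k f => [|k IH] f H.
  by move=> x /H[A [Ax]]; apply.
split=> [x /H[A [Ax [+ _]]]|v]; first by apply.
by apply: IH => x /H[A [Ax [_ +]]] => /(_ v) DA; exists A.
Qed.

Lemma Ck_sub V W k (U A : set V) (f : V -> W) :
  A `<=` U -> Ck k U f -> Ck k A f.
Proof. by move=> AU Uf; apply: Ck_local => x /AU Ux; exists U. Qed.

(** Openness of U matters: the differentials at a point of U see f and g on a
    whole neighbourhood of it. *)
Lemma Ck_eq V W k (U : set V) (f g : V -> W) : open U ->
  (forall x, U x -> f x = g x) -> Ck k U f -> Ck k U g.
Proof.
move=> oU; have near_U x : U x -> \forall y \near x, U y.
  by move=> Ux; exact: open_nbhs_nbhs.
elim: k f g => [|k IH] f g fg.
  move=> fc x Ux; rewrite /prop_for /continuous_at -(fg x Ux).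
  apply: cvg_trans (fc x Ux); apply: near_eq_cvg.
  by apply: filterS (near_U x Ux) => y /fg.
have fg_near x : U x -> \forall y \near x, f y = g y.
  by move=> /near_U; apply: filterS => y /fg.
move=> [df Df]; split=> [x Ux|v].
  by have [] := near_eq_diff (fg_near x Ux) (df x Ux).
apply: IH (Df v) => x Ux.
by have [_ ->] := near_eq_diff (fg_near x Ux) (df x Ux).
Qed.

Lemma Ck_cst V W k (U : set V) (w : W) : Ck k U (fun=> w).
Proof.
elim: k w => [|k IH] w; first by move=> x _; exact: cvg_cst.
split=> [x _|v]; first exact: differentiable_cst.
have -> : (fun x => 'd (fun=> w) x v) = (fun _ : V => 0 : W); last exact: IH.
by apply/funext => x; rewrite (_ : (fun=> w) = cst w)// diff_cst.
Qed.

Lemma Ck_linear V W k (U : set V) (f : {linear V -> W}) :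
  continuous f -> Ck k U f.
Proof.
move=> cf; case: k => [|k]; first by move=> x _; exact: cf.
split=> [x _|v]; first exact: linear_differentiable.
have -> : (fun x => 'd f x v) = (fun=> f v); last exact: Ck_cst.
by apply/funext => x; rewrite diff_lin.
Qed.

Lemma CkD V W k (U : set V) (f g : V -> W) : open U ->
  Ck k U f -> Ck k U g -> Ck k U (fun x => f x + g x).
Proof.
move=> oU; elim: k f g => [|k IH] f g.
  by move=> fc gc x Ux; apply: cvgD; [exact: fc|exact: gc].
move=> [df Df] [dg Dg]; split=> [x Ux|v].
  by apply: (@differentiableD _ _ _ f g); [exact: df|exact: dg].
apply: Ck_eq (IH _ _ (Df v) (Dg v)) => // x Ux.
exact/esym/(congr1 (fun h : V -> W => h v) (diffD (df x Ux) (dg x Ux))).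
Qed.

Lemma Ck_lincomp V W Z k (U : set V) (f : V -> W) (l : {linear W -> Z}) :
  open U -> continuous l -> Ck k U f -> Ck k U (fun x => l (f x)).
Proof.
move=> oU cl; elim: k f => [|k IH] f.
  by move=> fc x Ux; apply: continuous_comp; [exact: fc|exact: cl].
move=> [df Df]; split=> [x Ux|v].
  apply: (@differentiable_comp _ _ _ _ f l); first exact: df.
  exact: linear_differentiable.
apply: Ck_eq (IH _ (Df v)) => // x Ux.
rewrite (@diff_comp _ _ _ _ f l x (df x Ux)); last exact: linear_differentiable.
by rewrite /= diff_lin.
Qed.

Lemma Ck_sum V W k (U : set V) (I : finType) (f : I -> V -> W) : open U ->
  (forall i, Ck k U (f i)) -> Ck k U (fun x => \sum_i f i x).
Proof.
move=> oU fi; elim: (index_enum I) => [|i s IH].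
  by under eq_fun do rewrite big_nil; exact: Ck_cst.
by under eq_fun do rewrite big_cons; exact: CkD.
Qed.

(** The induction runs on b (f, g) itself, since its differential
    b (f, dg) + b (df, g) is a sum of terms of the same shape. *)
Lemma Ck_bilinear V W Z X k (U : set V) (b : {bilinear W -> Z -> X})
    (f : V -> W) (g : V -> Z) : open U -> continuous (fun p => b p.1 p.2) ->
  Ck k U f -> Ck k U g -> Ck k U (fun x => b (f x) (g x)).
Proof.
move=> oU cb; elim: k f g => [|k IH] f g.
  move=> fc gc x Ux.
  apply: (@continuous_comp _ _ _ (fun x => (f x, g x)) (fun p => b p.1 p.2)).
    by apply: cvg_pair; [exact: fc|exact: gc].
  exact: cb.
move=> fk gk; have [[df Df] [dg Dg]] := (fk, gk).
have dfg x : U x -> differentiable (fun x => (f x, g x)) x.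
  by move=> Ux; apply: differentiable_pair; [exact: df|exact: dg].
split=> [x /dfg ?|v].
  apply: (@differentiable_comp _ _ _ _ (fun x => (f x, g x))
    (fun p => b p.1 p.2)) => //.
  exact: differentiable_bilin.
apply: (@Ck_eq V X k U
  (fun x => b (f x) ('d g x v) + b ('d f x v) (g x))) => //.
  move=> x Ux; rewrite (@diff_comp _ _ _ _ (fun x => (f x, g x))
    (fun p => b p.1 p.2)); [|exact: dfg|exact: differentiable_bilin].
  by rewrite /= diff_bilin // diff_pair; [|exact: df|exact: dg].
apply: CkD => //.
  exact: IH (CkS fk) (Dg v).
exact: IH (Df v) (CkS gk).
Qed.

Lemma scale_bilinear W : bilinear_for
    (GRing.Scale.Law.clone _ _ *:%R _) (GRing.Scale.Law.clone _ _ *:%R _)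
    (fun (a : R^o) (w : W) => a *: w).
Proof.
split=> [w|a] c x y /=; first by rewrite scalerDl scalerA.
by rewrite scalerDr !scalerA mulrC.
Qed.

Lemma CkZ V W k (U : set V) (s : V -> R^o) (f : V -> W) : open U ->
  Ck k U s -> Ck k U f -> Ck k U (fun x => s x *: f x).
Proof.
move=> oU sk fk.
pose bM := bilinear_isBilinear.Build R R^o W W _ _ _ (@scale_bilinear W).
pose b : {bilinear R^o -> W -> W} :=
  HB.pack (fun (a : R^o) (w : W) => a *: w) bM.
apply: (@Ck_bilinear _ _ _ _ k U b) => // p.
by apply: cvgZ; [exact: cvg_fst|exact: cvg_snd].
Qed.

Lemma Ck_pair V W Z k (U : set V) (f : V -> W) (g : V -> Z) : open U ->
  Ck k U f -> Ck k U g -> Ck k U (fun x => (f x, g x)).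
Proof.
move=> oU; elim: k f g => [|k IH] f g.
  by move=> fc gc x Ux; apply: cvg_pair; [exact: fc|exact: gc].
move=> [df Df] [dg Dg]; split=> [x Ux|v].
  by apply: differentiable_pair; [exact: df|exact: dg].
apply: Ck_eq (IH _ _ (Df v) (Dg v)) => // x Ux.
by rewrite diff_pair; [|exact: df|exact: dg].
Qed.

(** Finite dimension, in the form used to differentiate a composition: finitely
    many vectors together with continuous coordinate forms. *)
Definition fin_coords W : Prop :=
  exists (I : finType) (b : I -> W) (c : I -> {linear W -> R^o}),
    (forall i, continuous (c i)) /\ (forall w, w = \sum_i c i w *: b i).

(** In d(g o f) x v = dg (f x) (df x v) both the point and the direction move with
    x, while [Ck] only differentiates dg in a fixed direction.  Expanding df x v
    in coordinates of W leaves fixed directions b_i with C^k coefficients. *)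
Lemma Ck_comp V W Z k (U : set V) (A : set W) (f : V -> W) (g : W -> Z) :
    fin_coords W -> open U -> (forall x, U x -> A (f x)) ->
  Ck k U f -> Ck k A g -> Ck k U (fun x => g (f x)).
Proof.
move=> [I [b [c [cc bc]]]] oU UA; elim: k g => [|k IH] g.
  by move=> fc gc x Ux; apply: continuous_comp; [exact: fc|exact/gc/UA].
move=> fk [dg Dg]; have [df Df] := fk; split=> [x Ux|v].
  by apply: (@differentiable_comp _ _ _ _ f g); [exact: df|exact/dg/UA].
apply: (@Ck_eq V Z k U
  (fun x => \sum_i c i ('d f x v) *: 'd g (f x) (b i))) => //.
  move=> x Ux; rewrite (@diff_comp _ _ _ _ f g); [|exact: df|exact/dg/UA].
  rewrite /= [in RHS](bc ('d f x v)) linear_sum.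
  by under [RHS]eq_bigr do rewrite linearZ.
apply: Ck_sum => // i; apply: CkZ => //.
  exact: Ck_lincomp (Df v).
exact: IH (CkS fk) (Dg (b i)).
Qed.

Lemma Ck_fst V W k (U : set (V * W)%type) : Ck k U (fun x => x.1).
Proof.
by apply: (@Ck_linear _ _ _ _ (fst : {linear _ -> _})) => x; exact: cvg_fst.
Qed.

Lemma Ck_snd V W k (U : set (V * W)%type) : Ck k U (fun x => x.2).
Proof.
by apply: (@Ck_linear _ _ _ _ (snd : {linear _ -> _})) => x; exact: cvg_snd.
Qed.

Lemma Ck_id V k (U : set V) : Ck k U (fun x => x).
Proof. by apply: (@Ck_linear _ _ _ _ (idfun : {linear _ -> _})) => x. Qed.

Lemma fin_coords_prod V W :
  fin_coords V -> fin_coords W -> fin_coords (V * W)%type.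
Proof.
move=> [I [b [c [cc bc]]]] [J [d [e [ce de]]]].
exists (I + J)%type.
exists (fun k => match k with inl i => (b i, 0) | inr j => (0, d j) end).
exists (fun k => match k with
  | inl i => (c i \o fst : {linear _ -> _})
  | inr j => (e j \o snd : {linear _ -> _}) end).
split=> [[i|j] x|w].
- by apply: continuous_comp; [exact: cvg_fst|exact: cc].
- by apply: continuous_comp; [exact: cvg_snd|exact: ce].
rewrite [LHS]surjective_pairing [RHS]surjective_pairing.
congr (_, _); rewrite raddf_sum big_sumType /=.
  by rewrite -bc [X in _ + X]big1 ?addr0// => j _; rewrite scaler0.
by rewrite -de [X in X + _]big1 ?add0r// => j _; rewrite scaler0.
Qed.

Lemma fin_coords_matrix m n : fin_coords 'M[R]_(m, n).
Proof.
exists ('I_m * 'I_n)%type, (fun ij => delta_mx ij.1 ij.2).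
have lin (ij : 'I_m * 'I_n) :
    linear (fun A : 'M[R]_(m, n) => A ij.1 ij.2 : R^o).
  by move=> a A B; rewrite !mxE.
pose coord (ij : 'I_m * 'I_n) : {linear 'M[R]_(m, n) -> R^o} :=
  HB.pack (fun A : 'M[R]_(m, n) => A ij.1 ij.2 : R^o)
    (GRing.isLinear.Build _ _ _ _ _ (lin ij)).
exists coord.
split=> [ij|A]; first exact: coord_continuous.
by rewrite [LHS]matrix_sum_delta pair_bigA.
Qed.

End CkCalculus.

(** Continuity follows from writing the product as a finite sum of products of
    entries with constant matrices. *)
Lemma mulmx_continuous (R : realType) m p q :
  continuous (fun w : 'M[R]_(m, p) * 'M[R]_(p, q) => w.1 *m w.2).
Proof.
pose U := [set: 'M[R]_(m, p) * 'M[R]_(p, q)].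
have oU : open U by exact: openT.
suff C0 : Ck 0 U (fun w => w.1 *m w.2) by move=> w; exact: C0.
apply: (@Ck_eq _ _ _ 0 U (fun w => \sum_(t : ('I_m * 'I_q) * 'I_p)
    (w.1 t.1.1 t.2 : R^o) *:
    (w.2 t.2 t.1.2 *: delta_mx t.1.1 t.1.2 : 'M[R]_(m, q)))) => //.
  move=> w _; rewrite [RHS]matrix_sum_delta pair_bigA /=.
  rewrite -(pair_bigA _ (fun ij l => (w.1 ij.1 l : R^o) *:
    (w.2 l ij.2 *: delta_mx ij.1 ij.2 : 'M[R]_(m, q)))) /=.
  apply: eq_bigr => ij _; rewrite mxE scaler_suml.
  by apply: eq_bigr => l _; rewrite scalerA.
apply: Ck_sum => // t.
have c1 : Ck 0 U (fun w => w.1 t.1.1 t.2 : R^o).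
  move=> w _; apply: (@continuous_comp _ _ _ fst (fun A : 'M_(m, p) => A t.1.1 t.2)).
    exact: cvg_fst.
  exact: coord_continuous.
have c2 : Ck 0 U (fun w => w.2 t.2 t.1.2 : R^o).
  move=> w _; apply: (@continuous_comp _ _ _ snd (fun A : 'M_(p, q) => A t.2 t.1.2)).
    exact: cvg_snd.
  exact: coord_continuous.
exact: CkZ oU c1 (CkZ oU c2 (@Ck_cst _ _ _ 0 U (delta_mx t.1.1 t.1.2))).
Qed.

(** * Smooth maps between charted spaces *)

(** The axioms on charts alone: they are what computations in charts rely on, and
    they pass to products chart by chart, hence to the cotangent bundle. *)
Record smooth_atlas (R : realType) (V : normedModType R) (M : chartedSpace V) :
    Prop := SmoothAtlas {
  at_mem : forall p : M, chart_dom p p;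
  at_open : forall p : M, open (chart_dom p);
  at_open_img : forall p : M, open (chart_img p);
  at_cancel : forall p q : M, chart_dom p q -> chart_inv p (chart p q) = q;
  at_continuous : forall p : M, {within chart_dom p, continuous (chart p)};
  at_continuous_inv : forall p : M,
    {within chart_img p, continuous (chart_inv p)};
  at_transition : forall p q : M,
    smooth_on (chart p @` (chart_dom p `&` chart_dom q))
      (fun x => chart q (chart_inv p x)) }.

Lemma manifold_atlas (R : realType) (V : normedModType R) (M : chartedSpace V) :
  smooth_manifold M -> smooth_atlas M.
Proof. by case. Qed.

(** The transition maps are the local representatives of [id], so that every
    chain rule below is an instance of [local_rep_comp_diff]. *)
Definition local_rep (R : realType) (V W : normedModType R) (M : chartedSpace V)
    (N : chartedSpace W) (p : M) (q : N) (f : M -> N) : V -> W :=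
  fun x => chart q (f (chart_inv p x)).

Definition rep_dom (R : realType) (V W : normedModType R) (M : chartedSpace V)
    (N : chartedSpace W) (p : M) (q : N) (f : M -> N) : set V :=
  chart p @` (chart_dom p `&` f @^-1` chart_dom q).

Section Atlas.
Variables (R : realType) (V : normedModType R) (M : chartedSpace V).
Hypothesis hM : smooth_atlas M.

Lemma chart_img_inv (a : M) x : chart_img a x -> chart_dom a (chart_inv a x).
Proof. by move=> [p ap <-]; rewrite at_cancel. Qed.

Lemma chart_invK (a : M) x : chart_img a x -> chart a (chart_inv a x) = x.
Proof. by move=> [p ap <-]; rewrite at_cancel. Qed.

Lemma chart_continuous (a p : M) :
  chart_dom a p -> {for p, continuous (chart a)}.
Proof.
move=> ap; have := @at_continuous _ _ _ hM a.
by rewrite continuous_open_subspace; [apply; rewrite inE|exact: at_open].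
Qed.

Lemma chart_inv_continuous (a : M) x :
  chart_img a x -> {for x, continuous (chart_inv a)}.
Proof.
move=> ax; have := @at_continuous_inv _ _ _ hM a.
by rewrite continuous_open_subspace; [apply; rewrite inE|exact: at_open_img].
Qed.

Lemma chart_img_open (a : M) (A : set M) :
  open A -> open (chart a @` (chart_dom a `&` A)).
Proof.
move=> oA.
have -> : chart a @` (chart_dom a `&` A) = chart_img a `&` chart_inv a @^-1` A.
  apply/seteqP; split=> [_ [p [ap Ap] <-]|x [ax Ax]].
    by split; [exists p|rewrite /= at_cancel].
  exists (chart_inv a x); last exact: chart_invK.
  by split=> //; exact: chart_img_inv.
rewrite openE => x [ax Ax]; apply: filterI.
  by apply: open_nbhs_nbhs; split=> //; exact: at_open_img.
by apply: (chart_inv_continuous ax); apply: open_nbhs_nbhs.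
Qed.

End Atlas.

Section SmoothMapTheory.
Variables (R : realType) (V W : normedModType R).
Variables (M : chartedSpace V) (N : chartedSpace W).
Hypotheses (hM : smooth_atlas M) (hN : smooth_atlas N).
Variable f : M -> N.
Hypothesis fs : smooth_map M N f.

Lemma rep_dom_open (a : M) (b : N) : open (rep_dom a b f).
Proof.
apply: chart_img_open => //; apply: open_comp; last exact: at_open.
by move=> x _; exact: fs.1.
Qed.

Lemma local_rep_Ck k (a : M) (b : N) : Ck k (rep_dom a b f) (local_rep a b f).
Proof. exact: fs.2. Qed.

Lemma local_rep_diff (a : M) (b : N) p : chart_dom a p -> chart_dom b (f p) ->
  differentiable (local_rep a b f) (chart a p).
Proof. by move=> ap bp; apply: (local_rep_Ck 1 a b).1; exists p. Qed.

End SmoothMapTheory.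

Lemma open_setX (S T : topologicalType) (A : set S) (B : set T) :
  open A -> open B -> open (A `*` B).
Proof.
move=> oA oB; rewrite (_ : A `*` B = fst @^-1` A `&` snd @^-1` B)//.
by apply: openI; apply: open_comp => // x _; [exact: cvg_fst|exact: cvg_snd].
Qed.

Section SmoothMapConstructions.
Variable R : realType.
Implicit Types V W Z X : normedModType R.

Lemma smooth_map_local V W (M : chartedSpace V) (N : chartedSpace W)
    (f : M -> N) :
  continuous f ->
  (forall a b p k, chart_dom a p -> chart_dom b (f p) ->
    exists A, A (chart a p) /\ Ck k A (local_rep a b f)) ->
  smooth_map M N f.
Proof.
move=> cf H; split=> // a b k; apply: Ck_local => _ [p [ap bp] <-].
exact: H.
Qed.

(** Around a point p, the composition factors through the chart at f p, on the
    open set of points that f sends into the domain of that chart and g o f into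
    the domain of the target chart. *)
Lemma smooth_map_comp V W Z (M : chartedSpace V) (N : chartedSpace W)
    (P : chartedSpace Z) (f : M -> N) (g : N -> P) :
  fin_coords W -> smooth_atlas M -> smooth_atlas N -> smooth_atlas P ->
  smooth_map M N f -> smooth_map N P g -> smooth_map M P (fun p => g (f p)).
Proof.
move=> fW hM hN hP fs gs; apply: smooth_map_local => [p|a c p k ap cp].
  by apply: continuous_comp; [exact: fs.1|exact: gs.1].
have bp := at_mem hN (f p); set b := f p in bp.
pose B := chart_dom b `&` g @^-1` chart_dom c.
have oB : open B.
  apply: openI; first exact: at_open.
  by apply: open_comp => [x _|]; [exact: gs.1|exact: at_open].
have oA : open (chart a @` (chart_dom a `&` f @^-1` B)).
  by apply: chart_img_open => //; apply: open_comp => // x _; exact: fs.1.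
exists (chart a @` (chart_dom a `&` f @^-1` B)); split; first by exists p.
apply: (@Ck_eq _ _ _ _ _ (fun x => local_rep b c g (local_rep a b f x))) => //.
  move=> _ [q [aq [bq cq]] <-].
  by rewrite /local_rep (at_cancel hM)// (at_cancel hN).
apply: (@Ck_comp _ _ _ _ _ _ (rep_dom b c g)) => //.
- move=> _ [q [aq [bq cq]] <-]; rewrite /local_rep (at_cancel hM)//.
  by exists (f q).
- apply: Ck_sub (local_rep_Ck fs k a b).
  by move=> _ [q [aq [bq cq]] <-]; exists q.
- exact: local_rep_Ck.
Qed.

Lemma smooth_map_id V (M : chartedSpace V) :
  smooth_atlas M -> smooth_map M M id.
Proof.
by move=> hM; split=> [p|a b]; [exact: cvg_id|exact: at_transition].
Qed.

Lemma smooth_map_cst V W (M : chartedSpace V) (N : chartedSpace W) (q : N) :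
  smooth_map M N (fun=> q).
Proof. by split=> [p|a b k]; [exact: cvg_cst|exact: Ck_cst]. Qed.

Lemma smooth_map_pair V W Z (M : chartedSpace V) (N : chartedSpace W)
    (P : chartedSpace Z) (f : M -> N) (g : M -> P) :
  smooth_atlas M -> smooth_atlas N -> smooth_atlas P ->
  smooth_map M N f -> smooth_map M P g ->
  smooth_map M (prod_charted N P) (fun p => (f p, g p)).
Proof.
move=> hM hN hP fs gs; apply: smooth_map_local => [p|a b p k ap [/= bp cp]].
  by apply: cvg_pair; [exact: fs.1|exact: gs.1].
exists (rep_dom a b.1 f `&` rep_dom a b.2 g); split.
  by split; exists p.
apply: (@Ck_pair _ _ _ _ k _ (local_rep a b.1 f) (local_rep a b.2 g)).
- by apply: openI; exact: rep_dom_open.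
- by apply: Ck_sub (local_rep_Ck fs k a b.1) => x [].
- by apply: Ck_sub (local_rep_Ck gs k a b.2) => x [].
Qed.

Lemma smooth_atlas_vec V : smooth_atlas (vec_charted V).
Proof.
have imgT (v : V) : chart_img (v : vec_charted V) = setT.
  by apply/seteqP; split=> // x _; exists x.
split=> //.
- by move=> p; exact: openT.
- by move=> p; rewrite imgT; exact: openT.
- by move=> p; apply: continuous_subspaceT => x; exact: cvg_id.
- by move=> p; apply: continuous_subspaceT => x; exact: cvg_id.
- by move=> p q k; exact: Ck_id.
Qed.

Lemma prod_chart_img V W (M : chartedSpace V) (N : chartedSpace W)
    (a : prod_charted M N) :
  chart_img a = chart_img (a.1 : M) `*` chart_img (a.2 : N).
Proof.
apply/seteqP; split=> [_ [p [ap1 ap2] <-]|[x y] [/= [p ap <-] [q aq <-]]].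
  by split; [exists p.1|exists p.2].
by exists (p, q).
Qed.

Lemma smooth_atlas_prod V W (M : chartedSpace V) (N : chartedSpace W) :
  fin_coords V -> fin_coords W ->
  smooth_atlas M -> smooth_atlas N -> smooth_atlas (prod_charted M N).
Proof.
move=> fV fW hM hN; split.
- by move=> p; split; exact: at_mem.
- by move=> p; apply: open_setX; exact: at_open.
- by move=> p; rewrite prod_chart_img; apply: open_setX; exact: at_open_img.
- by move=> p q [/= pq1 pq2]; rewrite !at_cancel// -surjective_pairing.
- move=> p; rewrite continuous_open_subspace; last first.
    by apply: open_setX; exact: at_open.
  move=> q; rewrite inE => -[/= q1 q2]; apply: cvg_pair.
    by apply: (cvg_comp _ _ cvg_fst); exact: chart_continuous.
  by apply: (cvg_comp _ _ cvg_snd); exact: chart_continuous.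
- move=> p; rewrite prod_chart_img continuous_open_subspace; last first.
    by apply: open_setX; exact: at_open_img.
  move=> q; rewrite inE => -[/= q1 q2]; apply: cvg_pair.
    by apply: (cvg_comp _ _ cvg_fst); exact: chart_inv_continuous.
  by apply: (cvg_comp _ _ cvg_snd); exact: chart_inv_continuous.
- move=> p q k.
  pose A := chart p.1 @` (chart_dom p.1 `&` chart_dom q.1).
  pose B := chart p.2 @` (chart_dom p.2 `&` chart_dom q.2).
  have oA : open A by apply: chart_img_open => //; exact: at_open.
  have oB : open B by apply: chart_img_open => //; exact: at_open.
  apply: (@Ck_sub _ _ _ _ (A `*` B)).
    move=> _ [r [[/= r1 r2] [/= r3 r4]] <-].
    by split; [exists r.1|exists r.2].
  apply: Ck_pair; first exact: open_setX.
    apply: (@Ck_comp _ _ _ _ _ _ A fst (local_rep p.1 q.1 id)) => //.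
    + exact: open_setX.
    + by move=> x [].
    + exact: Ck_fst.
    + exact: (at_transition hM).
  apply: (@Ck_comp _ _ _ _ _ _ B snd (local_rep p.2 q.2 id)) => //.
  + exact: open_setX.
  + by move=> x [].
  + exact: Ck_snd.
  + exact: (at_transition hN).
Qed.

Lemma smooth_map_fst V W (M : chartedSpace V) (N : chartedSpace W) :
  fin_coords V -> fin_coords W -> smooth_atlas M -> smooth_atlas N ->
  smooth_map (prod_charted M N) M fst.
Proof.
move=> fV fW hM hN; apply: smooth_map_local => [p|a b p k [/= ap _] bp].
  exact: cvg_fst.
pose A := chart a.1 @` (chart_dom a.1 `&` chart_dom b).
have oA : open A by apply: chart_img_open => //; exact: at_open.
exists (A `*` setT); split; first by split=> //; exists p.1.
apply: (@Ck_comp _ _ _ _ _ _ A fst (local_rep a.1 b id)) => //.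
+ by apply: open_setX => //; exact: openT.
+ by move=> x [].
+ exact: Ck_fst.
+ exact: (at_transition hM).
Qed.

Lemma smooth_map_snd V W (M : chartedSpace V) (N : chartedSpace W) :
  fin_coords V -> fin_coords W -> smooth_atlas M -> smooth_atlas N ->
  smooth_map (prod_charted M N) N snd.
Proof.
move=> fV fW hM hN; apply: smooth_map_local => [p|a b p k [/= _ ap] bp].
  exact: cvg_snd.
pose A := chart a.2 @` (chart_dom a.2 `&` chart_dom b).
have oA : open A by apply: chart_img_open => //; exact: at_open.
exists (setT `*` A); split; first by split=> //; exists p.2.
apply: (@Ck_comp _ _ _ _ _ _ A snd (local_rep a.2 b id)) => //.
+ by apply: open_setX => //; exact: openT.
+ by move=> x [].
+ exact: Ck_snd.
+ exact: (at_transition hN).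
Qed.

(** Continuity is part of the definition of a smooth map; here it is recovered
    from the local representatives and the continuity of the charts. *)
Lemma smooth_map_vecP V W (M : chartedSpace V) (f : M -> W) : smooth_atlas M ->
  smooth_map M (vec_charted W) f <->
  forall a, smooth_on (chart_img a) (fun x => f (chart_inv a x)).
Proof.
move=> hM; split=> [fs a k|H].
  apply: Ck_sub (local_rep_Ck fs k a (0 : vec_charted W)).
  by move=> _ [p ap <-]; exists p.
apply: smooth_map_local => [p|a b p k ap _]; last first.
  by exists (chart_img a); split; [exists p|exact: H].
have pp := at_mem hM p; have ip : chart_img p (chart p p) by exists p.
have near_p : \forall q \near p, f (chart_inv p (chart p q)) = f q.
  apply: filterS (open_nbhs_nbhs (conj (at_open hM p) pp)) => q pq.
  by rewrite (at_cancel hM).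
rewrite /prop_for /continuous_at -(nbhs_singleton near_p).
apply: cvg_trans (near_eq_cvg near_p) _.
apply: (@continuous_comp _ _ _ (chart p) (fun x => f (chart_inv p x))).
  exact: (chart_continuous hM pp).
exact: (Ck_continuous (H p 0%N) ip).
Qed.

Lemma smooth_mapD V W (M : chartedSpace V) (f g : M -> W) : smooth_atlas M ->
  smooth_map M (vec_charted W) f -> smooth_map M (vec_charted W) g ->
  smooth_map M (vec_charted W) (fun p => f p + g p).
Proof.
move=> hM /(smooth_map_vecP _ hM) fs /(smooth_map_vecP _ hM) gs.
apply/(smooth_map_vecP _ hM) => a k; apply: CkD.
- exact: at_open_img.
- exact: fs.
- exact: gs.
Qed.

Lemma smooth_map_lincomp V W Z (M : chartedSpace V) (f : M -> W)
    (l : {linear W -> Z}) : smooth_atlas M -> continuous l ->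
  smooth_map M (vec_charted W) f ->
  smooth_map M (vec_charted Z) (fun p => l (f p)).
Proof.
move=> hM lc /(smooth_map_vecP _ hM) fs.
apply/(smooth_map_vecP _ hM) => a k; apply: Ck_lincomp.
- exact: at_open_img.
- exact: lc.
- exact: fs.
Qed.

Lemma smooth_map_bilinear V W Z X (M : chartedSpace V) (f : M -> W) (g : M -> Z)
    (b : {bilinear W -> Z -> X}) :
  smooth_atlas M -> continuous (fun p => b p.1 p.2) ->
  smooth_map M (vec_charted W) f -> smooth_map M (vec_charted Z) g ->
  smooth_map M (vec_charted X) (fun p => b (f p) (g p)).
Proof.
move=> hM bc /(smooth_map_vecP _ hM) fs /(smooth_map_vecP _ hM) gs.
apply/(smooth_map_vecP _ hM) => a k.
by apply: Ck_bilinear; [exact: at_open_img|exact: bc|exact: fs|exact: gs].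
Qed.

(** The chain rule in arbitrary charts around p, f p and g (f p).  With f or g
    equal to [id] it describes a change of charts. *)
Lemma local_rep_comp_diff V W Z (M : chartedSpace V) (N : chartedSpace W)
    (P : chartedSpace Z) (f : M -> N) (g : N -> P) a b c p :
  smooth_atlas M -> smooth_atlas N -> smooth_atlas P ->
  smooth_map M N f -> smooth_map N P g ->
  chart_dom a p -> chart_dom b (f p) -> chart_dom c (g (f p)) ->
  'd (local_rep a c (fun q => g (f q))) (chart a p) =
  'd (local_rep b c g) (chart b (f p)) \o 'd (local_rep a b f) (chart a p)
  :> (V -> Z).
Proof.
move=> hM hN hP fs gs ap bp cp.
have dg := local_rep_diff gs bp cp; have df := local_rep_diff fs ap bp.
have fp : local_rep a b f (chart a p) = chart b (f p).
  by rewrite /local_rep (at_cancel hM).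
have := @diff_comp _ _ _ _ (local_rep a b f) (local_rep b c g) (chart a p) df.
rewrite fp => /(_ dg) <-.
have dgf := @differentiable_comp _ _ _ _ (local_rep a b f) (local_rep b c g)
  (chart a p) df.
rewrite fp in dgf; have {}dgf := dgf dg.
have [|_ ->//] :=
  @near_eq_diff _ _ _ _ (local_rep a c (fun q => g (f q))) _ _ dgf.
have oA := rep_dom_open hM hN fs a b.
have : rep_dom a b f (chart a p) by exists p.
move=> /(conj oA)/open_nbhs_nbhs; apply: filterS => _ [q [aq bq] <-] /=.
by rewrite /local_rep (at_cancel hM)// (at_cancel hN).
Qed.

Lemma local_rep_id_diff V (M : chartedSpace V) (a : M) p :
  smooth_atlas M -> chart_dom a p ->
  'd (local_rep a a id) (chart a p) = id :> (V -> V).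
Proof.
move=> hM ap.
have di : differentiable (id : V -> V) (chart a p) by [].
have [|_ ->] := @near_eq_diff _ _ _ id (local_rep a a id) (chart a p) _ di.
  have ip : chart_img a (chart a p) by exists p.
  apply: filterS (open_nbhs_nbhs (conj (at_open_img hM a) ip)) => x ax.
  by rewrite /local_rep chart_invK.
exact: diff_val.
Qed.

End SmoothMapConstructions.

(** * Left translations and the left invariant frame *)

(** What left invariant calculus uses of a Lie group; T^*G is seen to be one from
    the charts and the operations of G. *)
Record smooth_group (R : realType) (V : normedModType R) (G : lieData V) :
    Prop := SmoothGroup {
  sg_atlas : smooth_atlas G;
  sg_assoc : associative (@lie_mul R V G);
  sg_one_mul : left_id (lie_one G) (@lie_mul R V G);
  sg_inv_mul : left_inverse (lie_one G) (@lie_inv R V G) (@lie_mul R V G);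
  sg_smooth_mul : smooth_map (prod_charted G G) G (fun p => lie_mul p.1 p.2);
  sg_smooth_inv : smooth_map G G (@lie_inv R V G) }.

Lemma lie_group_smooth_group (R : realType) (V : normedModType R)
    (G : lieData V) :
  is_lie_group G -> smooth_group G.
Proof. by case=> /manifold_atlas hG *; split. Qed.

Section SmoothGroup.
Variables (R : realType) (V : normedModType R) (G : lieData V).
Hypotheses (hG : smooth_group G) (fV : fin_coords V).

Let hA := sg_atlas hG.
Let e := lie_one G.

Lemma lie_mulV (g : G) : lie_mul g (lie_inv g) = e.
Proof.
set h := lie_inv g.
(* g h = (h^-1 h) (g h) = h^-1 ((h g) h), where h is a left inverse of g *)
rewrite -[LHS](sg_one_mul hG) -{1}(sg_inv_mul hG h) -(sg_assoc hG).
rewrite [lie_mul h (lie_mul g h)](sg_assoc hG) (sg_inv_mul hG).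
by rewrite sg_one_mul// sg_inv_mul.
Qed.

Lemma lie_mul1 (g : G) : lie_mul g e = g.
Proof. by rewrite /e -(sg_inv_mul hG g) (sg_assoc hG) lie_mulV sg_one_mul. Qed.

Lemma smooth_mul_left (g : G) : smooth_map G G (lie_mul g).
Proof.
apply: (@smooth_map_comp _ _ _ _ G (prod_charted G G) G (fun h => (g, h))
  (fun p => lie_mul p.1 p.2)).
- exact: fin_coords_prod.
- exact: hA.
- exact: smooth_atlas_prod.
- exact: hA.
- by apply: smooth_map_pair; [| | |exact: smooth_map_cst|exact: smooth_map_id].
- exact: sg_smooth_mul.
Qed.

(** The map behind the Maurer-Cartan form, which is its derivative in the second
    argument along the diagonal. *)
Lemma smooth_div :
  smooth_map (prod_charted G G) G (fun p => lie_mul (lie_inv p.1) p.2).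
Proof.
have hGG : smooth_atlas (prod_charted G G) by exact: smooth_atlas_prod.
apply: (@smooth_map_comp _ _ _ _ (prod_charted G G) (prod_charted G G) G
  (fun p => (lie_inv p.1, p.2)) (fun p => lie_mul p.1 p.2)) => //.
- exact: fin_coords_prod.
- apply: smooth_map_pair => //; last exact: smooth_map_snd.
  apply: (@smooth_map_comp _ _ _ _ (prod_charted G G) G G fst
    (@lie_inv R V G)) => //.
    exact: smooth_map_fst.
  exact: sg_smooth_inv.
- exact: sg_smooth_mul.
Qed.

(** The Maurer-Cartan form: the tangent vector at p brought back to the Lie
    algebra by the left translation by p^-1. *)
Definition maurer_cartan (p : G) (v : V) : V :=
  tangent_map G G (lie_mul (lie_inv p)) p v.

(** The value of x^+ at p is read in the chart at p * e, which is the chart at p. *)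
Lemma left_fieldE (x : V) (p : G) :
  left_field G x p = 'd (local_rep e p (lie_mul p)) (chart e e) x.
Proof. by rewrite /left_field /tangent_map -/e lie_mul1. Qed.

Lemma maurer_cartanE (p : G) (v : V) :
  maurer_cartan p v = 'd (local_rep p e (lie_mul (lie_inv p))) (chart p p) v.
Proof. by rewrite /maurer_cartan /tangent_map sg_inv_mul. Qed.

Lemma left_field_maurer_cartan (p : G) (v : V) :
  left_field G (maurer_cartan p v) p = v.
Proof.
have pp := at_mem hA p.
have := @local_rep_comp_diff _ _ _ _ G G G (lie_mul (lie_inv p)) (lie_mul p)
  p e p p hA hA hA (smooth_mul_left _) (smooth_mul_left _) pp.
rewrite (sg_inv_mul hG) lie_mul1 => /(_ (at_mem hA e) pp) E.
rewrite maurer_cartanE left_fieldE -[LHS]/((_ \o _) v) -E.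
rewrite (_ : (fun q => _) = id) ?local_rep_id_diff//.
by apply/funext => q /=; rewrite (sg_assoc hG) lie_mulV sg_one_mul.
Qed.

Lemma maurer_cartan_left_field (p : G) (x : V) :
  maurer_cartan p (left_field G x p) = x.
Proof.
have pp := at_mem hA p; have ee := at_mem hA e.
have := @local_rep_comp_diff _ _ _ _ G G G (lie_mul p) (lie_mul (lie_inv p))
  e p e e hA hA hA (smooth_mul_left _) (smooth_mul_left _) ee.
rewrite lie_mul1 (sg_inv_mul hG) => /(_ pp ee) E.
rewrite maurer_cartanE left_fieldE -[LHS]/((_ \o _) x) -E.
rewrite (_ : (fun q => _) = id) ?local_rep_id_diff//.
by apply/funext => q /=; rewrite (sg_assoc hG) (sg_inv_mul hG) sg_one_mul.
Qed.

Lemma left_field_one (x : V) : left_field G x e = x.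
Proof.
have ee := at_mem hA e.
rewrite left_fieldE (_ : lie_mul e = id) ?local_rep_id_diff//.
by apply/funext => q; rewrite sg_one_mul.
Qed.

Lemma field_repE (q : G) (X : G -> V) y :
  field_rep q X y = 'd (local_rep (chart_inv q y) q id)
     (chart (chart_inv q y) (chart_inv q y)) (X (chart_inv q y)).
Proof. by []. Qed.

(** In a chart, x^+ is the partial derivative of the multiplication in the second
    argument at e, in the fixed direction x. *)
Lemma smooth_left_field (x : V) : smooth_field (left_field G x).
Proof.
move=> q k; have ee := at_mem hA e.
have hGG : smooth_atlas (prod_charted G G) by exact: smooth_atlas_prod.
pose mul := fun p : prod_charted G G => lie_mul p.1 p.2.
pose m := local_rep ((q, e) : prod_charted G G) q mul.
pose S := rep_dom ((q, e) : prod_charted G G) q mul.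
have mS : Ck k.+1 S m by exact: local_rep_Ck (sg_smooth_mul hG) _ _ _.
have inS y : chart_img q y -> S (y, chart e e).
  move=> [p qp <-]; exists (p, e); last by [].
  by split; [split|rewrite /mul /= lie_mul1].
have oI := at_open_img hA q.
have Ek : Ck k (chart_img q) (fun y => 'd m (y, chart e e) (0, x)).
  apply: (@Ck_comp _ _ _ _ k _ S (fun y => (y, chart e e))
    (fun w => 'd m w (0, x))) => //.
  - exact: fin_coords_prod.
  - by apply: Ck_pair => //; [exact: Ck_id|exact: Ck_cst].
  - exact: mS.2.
apply: Ck_eq Ek => // y qy.
rewrite field_repE left_fieldE; set p := chart_inv q y.
have pp := at_mem hA p; have qp : chart_dom q p by exact: chart_img_inv.
have := @local_rep_comp_diff _ _ _ _ G G G (lie_mul p) id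
  e p q e hA hA hA (smooth_mul_left _) (smooth_map_id hA) ee.
rewrite lie_mul1 => /(_ pp qp) E.
rewrite -[RHS]/((_ \o _) x) -E -diff_pair_cst//.
exact/mS.1/inS.
Qed.

(** In a chart, the form applied to X at y is dm (y, y) (0, X y), where m
    represents (p, q) |-> p^-1 q.  The direction varies with y and is therefore
    expanded in coordinates, as for compositions. *)
Lemma smooth_maurer_cartan (X : G -> V) : smooth_field X ->
  smooth_map G (vec_charted V) (fun p => maurer_cartan p (X p)).
Proof.
move=> Xs; apply/(smooth_map_vecP _ hA) => q k; have ee := at_mem hA e.
have [I [b [c [cc bc]]]] := fV.
have hGG : smooth_atlas (prod_charted G G) by exact: smooth_atlas_prod.
pose dv := fun p : prod_charted G G => lie_mul (lie_inv p.1) p.2.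
pose m := local_rep ((q, q) : prod_charted G G) e dv.
pose S := rep_dom ((q, q) : prod_charted G G) e dv.
have mS : Ck k.+1 S m by exact: local_rep_Ck smooth_div _ _ _.
have inS y : chart_img q y -> S (y, y).
  move=> [p qp <-]; exists (p, p); last by [].
  by split; [split|rewrite /dv /= sg_inv_mul].
have oI := at_open_img hA q.
have Ek : Ck k (chart_img q)
    (fun y => \sum_i c i (field_rep q X y) *: 'd m (y, y) (0, b i)).
  apply: Ck_sum => // i; apply: CkZ => //; first exact: Ck_lincomp (Xs q k).
  apply: (@Ck_comp _ _ _ _ k _ S (fun y => (y, y))
    (fun w => 'd m w (0, b i))) => //.
  - exact: fin_coords_prod.
  - by apply: Ck_pair => //; exact: Ck_id.
  - exact: mS.2.
apply: Ck_eq Ek => // y qy.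
have dm : differentiable m (y, y) by exact/mS.1/inS.
transitivity ('d (fun t => m (y, t)) y (field_rep q X y)).
  rewrite [in RHS](bc (field_rep q X y)) linear_sum; apply: eq_bigr => i _.
  by rewrite linearZ diff_pair_cst.
rewrite field_repE maurer_cartanE; set p := chart_inv q y.
have pp := at_mem hA p; have qp : chart_dom q p by exact: chart_img_inv.
have := @local_rep_comp_diff _ _ _ _ G G G id (lie_mul (lie_inv p))
  p q e p hA hA hA (smooth_map_id hA) (smooth_mul_left _) pp.
rewrite (sg_inv_mul hG) => /(_ qp ee) E.
by rewrite [in RHS]E /= /p chart_invK.
Qed.

End SmoothGroup.

(** * Left invariant connections and parallel endomorphisms *)

Section SmoothFields.
Variables (R : realType) (V : normedModType R) (M : chartedSpace V).
Hypothesis hM : smooth_atlas M.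

Lemma smooth_field0 : smooth_field (fun _ : M => 0 : V).
Proof.
move=> q k; apply: Ck_eq (@Ck_cst _ _ _ k (chart_img q) 0) => [|x _].
  exact: at_open_img.
by rewrite /field_rep /tangent_map linear0.
Qed.

Lemma smooth_fieldD (X Y : M -> V) :
  smooth_field X -> smooth_field Y -> smooth_field (fun p => X p + Y p).
Proof.
move=> Xs Ys q k; apply: Ck_eq (CkD _ (Xs q k) (Ys q k)) => [|x _|].
- exact: at_open_img.
- by rewrite /field_rep /tangent_map linearD.
- exact: at_open_img.
Qed.

Lemma smooth_fieldZ (f : M -> R^o) (X : M -> V) :
  smooth_fun f -> smooth_field X -> smooth_field (fun p => f p *: X p).
Proof.
move=> /(smooth_map_vecP _ hM) fs Xs q k.
apply: Ck_eq (CkZ _ (fs q k) (Xs q k)) => [|x _|].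
- exact: at_open_img.
- by rewrite /field_rep /tangent_map linearZ.
- exact: at_open_img.
Qed.

Lemma smooth_field_sum (I : Type) (s : seq I) (f : I -> M -> R^o)
    (X : I -> M -> V) :
  (forall i, smooth_fun (f i)) -> (forall i, smooth_field (X i)) ->
  smooth_field (fun p => \sum_(i <- s) f i p *: X i p).
Proof.
move=> fs Xs; elim: s => [|i s IH].
  by under eq_fun do rewrite big_nil; exact: smooth_field0.
under eq_fun do rewrite big_cons; apply: smooth_fieldD => //.
exact: smooth_fieldZ.
Qed.

Variable D : (M -> V) -> (M -> V) -> (M -> V).
Hypothesis hD : is_connection D.

Lemma conn_0l (Y : M -> V) p : smooth_field Y -> D (fun=> 0) Y p = 0.
Proof.
move=> Ys; have s0 := smooth_field0.
have := conn_addl hD s0 s0 Ys p.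
under [X in D X]eq_fun do rewrite addr0.
by move/eqP; rewrite -[X in X == _]addr0 (inj_eq (addrI _)) => /eqP.
Qed.

Lemma conn_0r (X : M -> V) p : smooth_field X -> D X (fun=> 0) p = 0.
Proof.
move=> Xs; have s0 := smooth_field0.
have := conn_addr hD Xs s0 s0 p.
under [X in D _ X]eq_fun do rewrite addr0.
by move/eqP; rewrite -[X in X == _]addr0 (inj_eq (addrI _)) => /eqP.
Qed.

Lemma conn_suml (I : Type) (s : seq I) (f : I -> M -> R^o) (X : I -> M -> V)
    (Y : M -> V) p :
  (forall i, smooth_fun (f i)) -> (forall i, smooth_field (X i)) ->
  smooth_field Y ->
  D (fun q => \sum_(i <- s) f i q *: X i q) Y p =
  \sum_(i <- s) f i p *: D (X i) Y p.
Proof.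
move=> fs Xs Ys; elim: s => [|i s IH].
  by rewrite big_nil; under [X in D X]eq_fun do rewrite big_nil; exact: conn_0l.
rewrite big_cons -IH -(conn_scalel hD)//.
rewrite -(conn_addl hD)//; [|exact: smooth_fieldZ|exact: smooth_field_sum].
by under [X in D X]eq_fun do rewrite big_cons.
Qed.

Lemma conn_sumr (I : Type) (s : seq I) (f : I -> M -> R^o) (X : M -> V)
    (Y : I -> M -> V) p :
  (forall i, smooth_fun (f i)) -> smooth_field X ->
  (forall i, smooth_field (Y i)) ->
  D X (fun q => \sum_(i <- s) f i q *: Y i q) p =
  \sum_(i <- s) (field_app X (f i) p *: Y i p + f i p *: D X (Y i) p).
Proof.
move=> fs Xs Ys; elim: s => [|i s IH].
  rewrite big_nil; under [X in D _ X]eq_fun do rewrite big_nil.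
  exact: conn_0r.
rewrite big_cons -IH -(conn_leibniz hD)//.
rewrite -(conn_addr hD)//; [|exact: smooth_fieldZ|exact: smooth_field_sum].
by under [X in D _ X]eq_fun do rewrite big_cons.
Qed.

End SmoothFields.

Section LeftInvariantConnection.
Variables (R : realType) (V : normedModType R) (G : lieData V).
Hypotheses (hG : smooth_group G) (fV : fin_coords V).

Lemma left_endo_left_field (j : V -> V) (x : V) p :
  left_endo G j p (left_field G x p) = left_field G (j x) p.
Proof.
by rewrite /left_endo -/(maurer_cartan p _) maurer_cartan_left_field.
Qed.

Lemma left_endo_linear (j : V -> V) p : linear j -> linear (left_endo G j p).
Proof.
by move=> lj a u v; rewrite /left_endo /tangent_map linearP lj linearP.
Qed.

(** On a Lie group, a connection and an endomorphism field that are both left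
    invariant are compatible as soon as they are at the level of the Lie algebra:
    the Leibniz terms in the frame (b_i^+) agree because J is pointwise linear. *)
Theorem parallel_left_endo (D : (G -> V) -> (G -> V) -> (G -> V))
    (B : V -> V -> V) (j : V -> V) :
  is_connection D ->
  (forall x y p,
     D (left_field G x) (left_field G y) p = left_field G (B x y) p) ->
  linear j -> (forall x y, B x (j y) = j (B x y)) ->
  parallel_endo D (left_endo G j).
Proof.
move=> hD DB lj Bj X Y Xs Ys p; have hA := sg_atlas hG.
have [I [b [c [cc bc]]]] := fV.
pose Jp : {linear V -> V} :=
  HB.pack (left_endo G j p)
    (GRing.isLinear.Build _ _ _ _ _ (left_endo_linear p lj)).
(* the coefficients of a field in the left invariant frame *)
pose co (Z : G -> V) i : G -> R^o := fun q => c i (maurer_cartan q (Z q)).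
have cos Z i : smooth_field Z -> smooth_fun (co Z i).
  by move=> Zs; apply: smooth_map_lincomp => //; exact: smooth_maurer_cartan.
have frame (Z : G -> V) : Z = fun q => \sum_i co Z i q *: left_field G (b i) q.
  apply/funext => q; rewrite -[LHS](left_field_maurer_cartan hG fV q (Z q)).
  rewrite {1}(bc (maurer_cartan q (Z q))) /left_field /tangent_map linear_sum.
  by apply: eq_bigr => i _; rewrite linearZ.
have JY q : left_endo G j q (Y q) = \sum_i co Y i q *: left_field G (j (b i)) q.
  pose Jq : {linear V -> V} :=
    HB.pack (left_endo G j q)
      (GRing.isLinear.Build _ _ _ _ _ (left_endo_linear q lj)).
  rewrite -[LHS]/(Jq (Y q)) [in LHS](frame Y) linear_sum.
  by apply: eq_bigr => i _; rewrite linearZ /= left_endo_left_field.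
have lfs x : smooth_field (left_field G x) by exact: smooth_left_field.
have DX x : D X (left_field G x) p =
    \sum_a co X a p *: left_field G (B (b a) x) p.
  rewrite {1}(frame X) (conn_suml hA hD)//; last by move=> i; exact: cos.
  by apply: eq_bigr => a _; rewrite DB.
rewrite /cov_deriv_endo (funext JY) (conn_sumr hA hD)//; last first.
  by move=> i; exact: cos.
rewrite -[left_endo G j p _]/(Jp _) [in X in _ - X](frame Y).
rewrite (conn_sumr hA hD)//; last by move=> i; exact: cos.
apply/eqP; rewrite subr_eq0 linear_sum; apply/eqP; apply: eq_bigr => i _.
rewrite linearD !linearZ /= left_endo_left_field !DX; congr (_ + _ *: _).
rewrite -[RHS]/(Jp _) linear_sum; apply: eq_bigr => a _.
by rewrite linearZ /= left_endo_left_field Bj.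
Qed.

End LeftInvariantConnection.

(** * The cotangent group and the Hess connection *)

Section Cotangent.
Variables (R : realType) (n : nat) (G : lieData 'rV[R]_n) (F : G -> 'M[R]_n).
Hypotheses (hG : smooth_group G) (hF : is_GL_dual_hom F).

Let fr : fin_coords 'rV[R]_n := @fin_coords_matrix R 1 n.
Let fc : fin_coords 'cV[R]_n := @fin_coords_matrix R n 1.

Lemma GL_dual_hom_one : F (lie_one G) = 1%:M.
Proof.
have FF : F (lie_one G) *m F (lie_one G) = F (lie_one G).
  by rewrite -(gl_mul hF) (sg_one_mul hG).
by rewrite -[LHS](mulKmx (gl_unit hF (lie_one G))) FF mulVmx ?(gl_unit hF).
Qed.

(** T^*G is the semidirect product of G and g^* along F. *)
Lemma smooth_group_cotangent : smooth_group (cotangent F).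
Proof.
have hA := sg_atlas hG; pose C := vec_charted 'cV[R]_n.
have hC : smooth_atlas C by exact: smooth_atlas_vec.
have hM : smooth_atlas (vec_charted 'M[R]_n) by exact: smooth_atlas_vec.
have hT : smooth_atlas (prod_charted G C) by exact: smooth_atlas_prod.
have fT : fin_coords ('rV[R]_n * 'cV[R]_n)%type by exact: fin_coords_prod.
have hTT : smooth_atlas (prod_charted (prod_charted G C) (prod_charted G C)).
  exact: smooth_atlas_prod.
have base : smooth_map (prod_charted G C) G fst by exact: smooth_map_fst.
have fibre : smooth_map (prod_charted G C) C snd by exact: smooth_map_snd.
split.
- exact: hT.
- move=> [g a] [h b] [k c]; rewrite /= (sg_assoc hG) (gl_mul hF).
  by rewrite mulmxDr mulmxA addrA.
- by move=> [g a]; rewrite /= (sg_one_mul hG) GL_dual_hom_one mul1mx addr0.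
- by move=> [g a]; rewrite /= (sg_inv_mul hG) subrr.
- apply: smooth_map_pair => //.
    apply: (@smooth_map_comp _ _ _ _ _ (prod_charted G G) _
      (fun p : prod_charted (prod_charted G C) (prod_charted G C) => (p.1.1, p.2.1))
      (fun p => lie_mul p.1 p.2)) => //; last exact: sg_smooth_mul.
    + exact: fin_coords_prod.
    + exact: smooth_atlas_prod.
    + apply: smooth_map_pair => //; apply: smooth_map_comp base => //.
        exact: smooth_map_fst.
      exact: smooth_map_snd.
  apply: smooth_mapD => //; last first.
    by apply: smooth_map_comp fibre => //; exact: smooth_map_fst.
  apply: smooth_map_bilinear => //; first exact: mulmx_continuous.
    apply: smooth_map_comp (gl_smooth hF) => //.
    by apply: smooth_map_comp base => //; exact: smooth_map_fst.
  by apply: smooth_map_comp fibre => //; exact: smooth_map_snd.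
have inv_base : smooth_map (prod_charted G C) G (fun p => lie_inv p.1).
  by apply: smooth_map_comp (sg_smooth_inv hG).
apply: smooth_map_pair => //.
apply: (@smooth_map_lincomp _ _ _ _ _ _ (-%R : {linear _ -> _})) => //.
  by move=> x; exact: opp_continuous.
apply: smooth_map_bilinear => //; first exact: mulmx_continuous.
exact: smooth_map_comp (gl_smooth hF).
Qed.

End Cotangent.

Section Metric.
Variables (R : realType) (n : nat) (k : 'rV[R]_n -> 'rV[R]_n -> R).
Hypothesis k_lin : forall (a : R) u v w, k (a *: u + v) w = a * k u w + k v w.
Hypothesis k_sym : forall u v, k u v = k v u.
Hypothesis k_nondeg : forall u, (forall v, k u v = 0) -> u = 0.

Lemma k_linr (a : R) u v w : k u (a *: v + w) = a * k u v + k u w.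
Proof. by rewrite !(k_sym u) k_lin. Qed.

Lemma ev_covec (f : {linear 'rV[R]_n -> R^o}) x : ev (covec f) x = f x.
Proof.
rewrite /ev /covec mxE [in RHS](row_sum_delta x) linear_sum; apply: eq_bigr => i _.
by rewrite mxE linearZ.
Qed.

Lemma ev_flat_map x y : ev (flat_map k x) y = k x y.
Proof.
have lk : linear (k x : 'rV[R]_n -> R^o) by move=> a u v; exact: k_linr.
pose f : {linear 'rV[R]_n -> R^o} :=
  HB.pack (k x : 'rV[R]_n -> R^o) (GRing.isLinear.Build _ _ _ _ _ lk).
exact: (ev_covec f).
Qed.

Lemma flat_map_linear : linear (flat_map k).
Proof. by move=> a u v; apply/matrixP => i j; rewrite !mxE k_lin. Qed.

Lemma flat_map_inj : injective (flat_map k).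
Proof.
move=> x y xy; apply/eqP; rewrite -subr_eq0; apply/eqP/k_nondeg => v.
rewrite addrC -scaleN1r k_lin -!ev_flat_map xy.
by rewrite mulN1r addNr.
Qed.

(** [sharp_map] picks a preimage of the musical isomorphism; one exists because k
    is nondegenerate, so that the square matrix of [flat_map] has a trivial
    kernel. *)
Lemma flat_sharp_map a : flat_map k (sharp_map k a) = a.
Proof.
pose f : {linear 'rV[R]_n -> 'cV[R]_n} :=
  HB.pack (flat_map k) (GRing.isLinear.Build _ _ _ _ _ flat_map_linear).
(* transposed, so that it acts on rows and has a square matrix *)
pose f' : {linear 'rV[R]_n -> 'rV[R]_n} := trmx \o f.
pose A := lin1_mx f'.
have Au : A \in unitmx.
  rewrite -row_free_unit -kermx_eq0; apply/eqP/row_matrixP => i.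
  have := congr1 (row i) (mulmx_ker A); rewrite row_mul mul_rV_lin1 /= !row0 => Ei.
  apply: flat_map_inj; rewrite -[RHS]/(f 0) linear0.
  by apply: trmx_inj; rewrite trmx0.
apply: (@getPex _ [set z | flat_map k z = a]).
exists (a^T *m invmx A) => /=; apply: trmx_inj.
by rewrite -[LHS]/(f' _) -mul_rV_lin1 mulmxKV.
Qed.

Lemma jmap_linear : linear (jmap k).
Proof.
move=> a [x u] [y v]; rewrite /jmap /=.
congr (_, _).
  by apply: flat_map_inj; rewrite /= flat_map_linear !flat_sharp_map.
by rewrite -[RHS]/(a *: - flat_map k x - flat_map k y) flat_map_linear opprD scalerN.
Qed.

Variable L : 'rV[R]_n -> 'rV[R]_n -> 'rV[R]_n.
Hypothesis kL : forall x y z, k (L x y) z = - k y (L x z).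

(** Skewness of L for k says exactly that k^flat is an isomorphism between the
    representations L and L^*. *)
Lemma dual_rep_flat_map x y : dual_rep L x (flat_map k y) = flat_map k (L x y).
Proof.
by apply/matrixP => i j; rewrite !mxE ev_flat_map kL.
Qed.

Lemma dual_repN x a : dual_rep L x (- a) = - dual_rep L x a.
Proof. by apply/matrixP => i j; rewrite !mxE /ev mulmxN mxE. Qed.

(** In the component g^* this is [dual_rep_flat_map]; in the component g it is the
    same identity read through the inverse of k^flat. *)
Lemma jmap_hess x (u : 'rV[R]_n * 'cV[R]_n) :
  (L x (jmap k u).1, dual_rep L x (jmap k u).2) = jmap k (L x u.1, dual_rep L x u.2).
Proof.
case: u => y b; rewrite /jmap /= dual_repN dual_rep_flat_map; congr (_, _).
by apply: flat_map_inj; rewrite -dual_rep_flat_map !flat_sharp_map.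
Qed.

End Metric.

(** The derivative of the constant function kp (y^+, z^+) vanishes, and at the
    neutral element metric compatibility reads 0 = k (x . y, z) + k (y, x . z). *)
Lemma lsa_skew (R : realType) (n : nat) (G : lieData 'rV[R]_n)
  (kp : G -> 'rV[R]_n -> 'rV[R]_n -> R^o)
  (nabla : (G -> 'rV[R]_n) -> (G -> 'rV[R]_n) -> (G -> 'rV[R]_n)) :
  smooth_group G -> left_invariant_metric kp -> is_levi_civita kp nabla ->
  forall x y z, kp (lie_one G) (lsa nabla x y) z
    = - kp (lie_one G) y (lsa nabla x z).
Proof.
move=> hG inv lc x y z.
have fr : fin_coords 'rV[R]_n := @fin_coords_matrix R 1 n.
have lfs w : smooth_field (left_field G w) by exact: smooth_left_field.
have := lc_metric lc (lfs x) (lfs y) (lfs z) (lie_one G).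
rewrite !left_field_one //.
have -> : (fun q => kp q (left_field G y q) (left_field G z q))
   = fun=> kp (lie_one G) y z.
  by apply/funext => q; rewrite -[RHS](inv q) (lie_mul1 hG).
rewrite /field_app /tangent_map (_ : (fun _ => _) = cst (kp (lie_one G) y z))//.
rewrite diff_cst => /esym/eqP; rewrite addr_eq0 => /eqP ->.
by [].
Qed.

Theorem corollary3p4 (R : realType) (n : nat) (G : lieData 'rV[R]_n)
  (kp : G -> 'rV[R]_n -> 'rV[R]_n -> R^o)
  (nabla : (G -> 'rV[R]_n) -> (G -> 'rV[R]_n) -> (G -> 'rV[R]_n))
  (F : G -> 'M[R]_n)
  (nablaH : (cotangent F -> 'rV[R]_n * 'cV[R]_n) ->
            (cotangent F -> 'rV[R]_n * 'cV[R]_n) ->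
            (cotangent F -> 'rV[R]_n * 'cV[R]_n)) :
  is_lie_group G -> simply_connected R G ->
  is_pseudo_riemannian kp -> left_invariant_metric kp ->
  is_levi_civita kp nabla -> flat nabla ->
  is_GL_dual_hom F -> has_differential F (dual_rep (lsa nabla)) ->
  is_hess (lsa nabla) nablaH ->
  parallel_endo nablaH (left_endo (cotangent F) (jmap (kp (lie_one G)))).
Proof.
move=> /lie_group_smooth_group hG _ hk inv lc _ hF _ [hD DH].
have k_lin := pr_linear hk (lie_one G).
have k_sym := @pr_sym _ _ _ _ hk (lie_one G).
have k_nd := @pr_nondegenerate _ _ _ _ hk (lie_one G).
have kL := lsa_skew hG inv lc.
apply: (parallel_left_endo (smooth_group_cotangent hG hF) _ hD
  (B := fun u v => (lsa nabla u.1 v.1, dual_rep (lsa nabla) u.1 v.2))).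
- by apply: fin_coords_prod; exact: fin_coords_matrix.
- by move=> [x a] [y b] p; exact: DH.
- exact: jmap_linear.
- by move=> x u; exact: jmap_hess.
Qed.
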